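(* Let $f \in \mathbb{Z}[X]$ be a monic quadratic polynomial with roots $\alpha,\beta$ such that $\alpha\beta = \pm 1$ and $\alpha/\beta$ is not a root of unity, and let $g \in \mathbb{Z}[X]$ be a monic polynomial with $f \mid g$. Write $(\alpha-\beta)^2 = D_0 D_1^2$ with $D_0, D_1 \in \mathbb{Z}$ and $D_0$ squarefree, and suppose $D_0 \ge 5$ and $D_0 \equiv 1 \pmod 4$. Then $m \in \mathfrak{M}(g)$ for every positive integer $m$ such that $8D_0 \mid m$ if $\alpha\beta = -1$, respectively $4D_0 \mid m$ if $\alpha\beta = +1$.
   Context: For a nonconstant monic polynomial $g(X) = X^r - c_1X^{r-1} - \cdots - c_r \in \mathbb{Z}[X]$, an integer linear recurrence with characteristic polynomial $g$ is an integer sequence $(s_n)_{n\ge 0}$ with $s_n = c_1 s_{n-1} + \cdots + c_r s_{n-r}$ for all $n \ge r$ (arbitrary integer initial conditions $s_0,\dots,s_{r-1}$). $\mathfrak{M}(g)$ is the set of positive integers $m$ for which there exist integer initial conditions and a positive integer $M$ such that the resulting recurrence takes exactly $m$ distinct residues modulo $M$. *)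

(* Defs.v *)
From mathcomp Require Import all_boot all_order all_algebra all_field.
From mathcomp Require Import boolp classical_sets functions cardinality.

Set Implicit Arguments.
Unset Strict Implicit.
Unset Printing Implicit Defensive.

Import Order.TTheory GRing.Theory Num.Theory.
Local Open Scope ring_scope.

(* For g = 'X^r - c_1 'X^(r-1) - ... - c_r, this is c_i (1 <= i <= r). *)
Definition rec_coef (g : {poly int}) (i : nat) : int :=
  - g`_((size g).-1 - i)%N.

(* The degree is r = (size g).-1, so i ranges over 1, ..., r and n - i is
   never truncated. *)
Definition is_lin_rec (g : {poly int}) (s : nat -> int) : Prop :=
  forall n : nat, ((size g).-1 <= n)%N ->
    s n = \sum_(1 <= i < size g) rec_coef g i * s (n - i)%N.

Definition residues (s : nat -> int) (M : nat) : set int :=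
  range (fun n : nat => (s n %% M%:Z)%Z).

(* The set written \mathfrak{M}(g). *)
Definition residue_counts (g : {poly int}) : set nat :=
  [set m : nat | (0 < m)%N /\
     exists (s : nat -> int) (M : nat),
       [/\ is_lin_rec g s, (0 < M)%N & (residues s M #= `I_m)%card]]%classic.

Definition squarefreez (d : int) : Prop :=
  forall e : int, (e ^+ 2 %| d)%Z -> e = 1 \/ e = -1.

(* Main.v *)
(** Let T and Q = ±1 be the trace and norm of alpha.  If f has a root r modulo
    a prime p and r has multiplicative order m, then the recurrence starting
    with 1, r is r ^ n modulo p and takes exactly m residues.  So it suffices
    to find p such that a root [a] of f in characteristic p has order m and
    lies in the prime field.

    Order: put e = 2 (Q = 1) or e = 4 (Q = -1), m = N * e, and let R be the
    integer Phi_N(alpha ^ e) * Phi_N(beta ^ e).  Since alpha ^ e has trace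
    s = t ^ 2 - 2 with s - 2 >= 5, |R| >= 5 ^ phi(N).  A prime dividing both R
    and N is odd and divides R at most twice, so if there were no other prime
    then |R| would be at most the square of the odd part of N, which is smaller
    than 5 ^ phi(N).  Modulo a prime p that divides R but not N, a root of f
    has order m.

    Rationality: otherwise Frobenius exchanges the roots, a ^ (p + 1) = Q and
    the hypothesis on m gives D0 | p + 1.  The product over 1 <= j <= (D0 - 1)/2
    of y ^ j - y ^ -j, with y a primitive D0-th root of unity, is a square root
    of D0 fixed by Frobenius, because (D0 - 1)/2 is even.  Hence a - b, which
    squares to D0 * D1 ^ 2, is fixed by Frobenius, a contradiction. *)

Require Import Defs.
From mathcomp Require Import all_boot all_order all_algebra all_field.
From mathcomp Require Import boolp classical_sets functions cardinality.
From mathcomp Require Import zify ring.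
Import Order.TTheory GRing.Theory Num.Theory.
Local Open Scope ring_scope.

(** * Integer symmetric functions of the two roots of a quadratic *)

(** Division of [P] by X^2 - t X + 1, run as a Horner scheme over the integers, so that a single
    remainder serves every ring. *)
Lemma horner_mod_quadratic (t : int) (P : {poly int}) :
  exists u v : int, forall (A : comNzRingType) (a : A),
    a ^+ 2 = t%:~R * a - 1 -> (map_poly intr P).[a] = u%:~R * a + v%:~R.
Proof.
elim/poly_ind: P => [|P c [u [v IH]]].
  by exists 0, 0 => A a _; rewrite rmorph0 horner0 mul0r addr0.
exists (u * t + v), (c - u) => A a ha.
rewrite rmorphD rmorphM /= map_polyX map_polyC hornerMXaddC (IH _ _ ha).
rewrite rmorphD rmorphB rmorphM /= mulrDl -mulrA -expr2 ha; ring.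
Qed.

(* The same integer r is read both in algC and in positive characteristic,
   hence the quantification over all rings. *)
Definition conj_norm (s : int) (P : {poly int}) (r : int) : Prop :=
  forall (A : comNzRingType) (a b : A), a + b = s%:~R -> a * b = 1 ->
    (map_poly intr P).[a] * (map_poly intr P).[b] = r%:~R.

Lemma conj_norm_exists (t : int) (P : {poly int}) :
  exists r : int, conj_norm t P r.
Proof.
have [u [v Puv]] := horner_mod_quadratic t P.
exists (u ^+ 2 + u * v * t + v ^+ 2) => A a b hs hp.
have ha : a ^+ 2 = t%:~R * a - 1 by rewrite -hs -hp; ring.
have hb : b ^+ 2 = t%:~R * b - 1 by rewrite -hs -hp; ring.
rewrite !Puv // !rmorphD !rmorphXn !rmorphM /= -hs.
transitivity (u%:~R ^+ 2 * (a * b) + u%:~R * v%:~R * (a + b) + v%:~R ^+ 2).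
  by ring.
by rewrite hp mulr1.
Qed.

(** The traces obey v_(j+2) = t v_(j+1) - v_j with v_0 = 2 and v_1 = t; modulo t - 2 this sequence
    is constantly 2. The congruence is needed for [centered_geometric_int]. *)
Lemma pow_trace_int (t : int) (j : nat) :
  exists v : int, (t - 2 %| v - 2)%Z /\
    forall (A : comNzRingType) (a b : A),
      a + b = t%:~R -> a * b = 1 -> a ^+ j + b ^+ j = v%:~R.
Proof.
suff [v [w [dv _ Av _]]] : exists v w : int,
    [/\ (t - 2 %| v - 2)%Z, (t - 2 %| w - 2)%Z,
      forall (A : comNzRingType) (a b : A),
        a + b = t%:~R -> a * b = 1 -> a ^+ j + b ^+ j = v%:~R
    & forall (A : comNzRingType) (a b : A),
        a + b = t%:~R -> a * b = 1 -> a ^+ j.+1 + b ^+ j.+1 = w%:~R].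
  by exists v.
elim: j => [|j [v [w [dv dw Av Aw]]]].
  by exists 2, t; split; rewrite ?subrr ?dvdz0 ?dvdzz.
exists w, (t * w - v); split=> // [|A a b hs hp].
  have -> : t * w - v - 2 = t * (w - 2) - (v - 2) + 2 * (t - 2) by ring.
  by apply: rpredD; first apply: rpredB; rewrite ?dvdz_mull.
rewrite rmorphB rmorphM /= -(Av A a b) // -(Aw A a b) // -hs !exprS.
transitivity (a * (a * a ^+ j) + b * (b * b ^+ j)
   + (a * b - 1) * (a ^+ j + b ^+ j)); first by rewrite hp; ring.
by ring.
Qed.

(** The centred sum is 1 plus the traces a ^ j + b ^ j for 1 <= j <= k, each congruent to 2 modulo t
    - 2. With 2 k + 1 = p it later bounds a p-adic valuation. *)
Lemma centered_geometric_int (t : int) (k : nat) :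
  exists S : int, (t - 2 %| S - (2 * k).+1%:Z)%Z /\
    forall (A : comNzRingType) (a b : A),
      a + b = t%:~R -> a * b = 1 ->
      b ^+ k * (\sum_(i < (2 * k).+1) a ^+ i) = S%:~R.
Proof.
elim: k => [|k [S [dS AS]]].
  exists 1; split=> [|A a b _ _]; first by rewrite muln0 subrr dvdz0.
  by rewrite muln0 big_ord1 !expr0 mulr1.
have [v [dv Av]] := pow_trace_int t k.+1.
exists (S + v); split=> [|A a b hs hp].
  have -> : S + v - (2 * k.+1).+1%:Z = (S - (2 * k).+1%:Z) + (v - 2) by lia.
  exact: rpredD.
rewrite rmorphD /= -(AS A a b) // -(Av A a b) // mulnS !addSn add0n.
rewrite big_ord_recl big_ord_recr /= expr0 /bump /= !add1n.
under eq_bigr => i _ do rewrite add1n exprS.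
rewrite -mulr_sumr; set s := \sum_(i < _) _.
have -> : a ^+ (2 * k).+2 = a ^+ k.+1 * a ^+ k.+1.
  by rewrite -exprD; congr (_ ^+ _); lia.
have hk : b ^+ k.+1 * a ^+ k.+1 = 1 by rewrite -exprMn mulrC hp expr1n.
transitivity (b ^+ k.+1 + (a * b) * (b ^+ k * s)
  + (b ^+ k.+1 * a ^+ k.+1) * a ^+ k.+1); first by rewrite !exprS; ring.
by rewrite hp hk; ring.
Qed.

(** * Roots of cyclotomic polynomials in a field *)

(** The sum is (X^n - 1) / (X^(n/q) - 1), the product of the cyclotomic polynomials of those
    divisors of n that do not divide n/q; n itself is one of them. *)
Lemma Cyclotomic_dvd_geometric (n q : nat) :
  (0 < n)%N -> prime q -> (q %| n)%N ->
  exists K : {poly int},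
    \sum_(i < q) ('X^(n %/ q)) ^+ i = 'Phi_n * K :> {poly int}.
Proof.
move=> n0 q_pr qn; set e := (n %/ q)%N.
have ne : n = (e * q)%N by rewrite divnK.
have e0 : (0 < e)%N by move: n0; rewrite ne muln_gt0 => /andP[].
have lt_en : (e < n)%N by rewrite ne -[ltnLHS]muln1 ltn_pmul2l ?prime_gt1.
exists (\prod_(d <- divisors n | (d != n) && ~~ (d %| e)%N) 'Phi_d).
have nz : 'X^e - 1 != 0 :> {poly int} by rewrite -size_poly_gt0 size_XnsubC.
apply: (mulfI nz); rewrite -subrX1 -exprM -ne -(prod_Cyclotomic n0).
rewrite (bigD1_seq n) ?divisors_id ?divisors_uniq //=.
rewrite (bigID (fun d => d %| e)%N) /= [LHS]mulrCA; congr (_ * _).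
rewrite -big_filter -(prod_Cyclotomic e0); apply: perm_big; apply: uniq_perm.
- by rewrite filter_uniq ?divisors_uniq.
- exact: divisors_uniq.
move=> d; rewrite mem_filter -!dvdn_divisors //.
case de: (d %| e)%N; rewrite ?andbF //= andbT.
rewrite ne dvdn_mulr // andbT -ne; apply: contraTneq de => ->.
by rewrite gtnNdvd.
Qed.

Lemma Cyclotomic_root_expr (F : fieldType) (n : nat) (x : F) :
  (0 < n)%N -> (map_poly intr 'Phi_n).[x] = 0 -> x ^+ n = 1.
Proof.
move=> n0 x0; apply/eqP; rewrite -subr_eq0.
have -> : x ^+ n - 1 = (map_poly intr ('X^n - 1 : {poly int})).[x].
  by rewrite rmorphB rmorph1 /= map_polyXn !hornerE.
rewrite -prod_Cyclotomic // (bigD1_seq n) ?divisors_id ?divisors_uniq //=.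
by rewrite rmorphM hornerM x0 mul0r.
Qed.

Lemma Cyclotomic_root_geometric (F : fieldType) (n q : nat) (x : F) :
  (0 < n)%N -> prime q -> (q %| n)%N -> (map_poly intr 'Phi_n).[x] = 0 ->
  \sum_(i < q) (x ^+ (n %/ q)) ^+ i = 0.
Proof.
move=> n0 q_pr qn x0.
have [K] := Cyclotomic_dvd_geometric n q n0 q_pr qn.
move/(congr1 (fun P => (map_poly (intr : int -> F) P).[x])).
rewrite rmorphM hornerM x0 mul0r rmorph_sum horner_sum => h; rewrite -[RHS]h.
by apply: eq_bigr => i _; rewrite /= -!exprM map_polyXn hornerXn.
Qed.

Lemma Cyclotomic_root_expr_neq1 (F : fieldType) (n q : nat) (x : F) :
  (0 < n)%N -> prime q -> (q %| n)%N -> (map_poly intr 'Phi_n).[x] = 0 ->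
  q%:R != 0 :> F -> x ^+ (n %/ q) != 1.
Proof.
move=> n0 q_pr qn x0; apply: contraNneq => xe.
rewrite -(Cyclotomic_root_geometric F n q x n0 q_pr qn x0) xe.
under eq_bigr do rewrite expr1n.
by rewrite sumr_const card_ord.
Qed.

Lemma prim_root_of_prime_quotients (R : nzRingType) (n : nat) (x : R) :
  (0 < n)%N -> x ^+ n = 1 ->
  (forall q, prime q -> (q %| n)%N -> x ^+ (n %/ q) != 1) ->
  n.-primitive_root x.
Proof.
move=> n0 xn hq; have [d dx dn] := prim_order_exists n0 xn.
have [<- //|ne] := eqVneq d n.
have d0 : (0 < d)%N := prim_order_gt0 dx.
have nd : (1 < n %/ d)%N by rewrite ltn_divRL // mul1n ltn_neqAle ne dvdn_leq.
have qn : (pdiv (n %/ d) %| n)%N.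
  by apply: dvdn_trans (pdiv_dvd _) _; rewrite -{2}(divnK dn) dvdn_mulr.
have /negP[] := hq _ (pdiv_prime nd) qn.
rewrite -(prim_order_dvd dx) dvdn_divRL // mulnC -dvdn_divRL //.
exact: pdiv_dvd.
Qed.

(** * Lower bound for the cyclotomic norm, compared with squares of odd numbers *)

(** For each primitive N-th root of unity c, a b = 1 gives (a - c)(b - c) = 1 + c^2 - t c, of
    modulus at least t - 2. *)
Lemma Cyclotomic_norm_ge (t : int) (N : nat) (a b : algC) :
  (0 < N)%N -> 2 <= t -> a + b = t%:~R -> a * b = 1 ->
  (t - 2)%:~R ^+ totient N
    <= `|(map_poly intr 'Phi_N).[a] * (map_poly intr 'Phi_N).[b]|.
Proof.
move=> N0 t2 hs hp; have [z pz] := C_prim_root_exists N0.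
rewrite (Cintr_Cyclotomic pz) /cyclotomic !horner_prod -big_split normr_prod /=.
have -> : ((t - 2)%:~R : algC) ^+ totient N
    = \prod_(k < N | coprime k N) (t - 2)%:~R.
  rewrite (prodr_const [pred k : 'I_N | coprime k N]) -sum1_card.
  rewrite totient_count_coprime big_mkord [in RHS]big_mkcond; congr (_ ^+ _).
  by apply: eq_bigr => i _; rewrite inE coprime_sym; case: coprime.
apply: ler_prod => k _; rewrite ler0z subr_ge0 t2 /= !hornerE.
have nz1 : `|z| = 1.
  apply/eqP; rewrite -(@pexpr_eq1 _ _ N) // -normrX (prim_expr_order pz).
  by rewrite normr1.
have nz : `|z ^+ k| = 1 by rewrite normrX nz1 expr1n.
have -> : (a - z ^+ k) * (b - z ^+ k) = 1 + z ^+ k * z ^+ k - t%:~R * z ^+ k.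
  by rewrite -hs -hp; ring.
have := lerB_dist (t%:~R * z ^+ k) (1 + z ^+ k * z ^+ k).
rewrite distrC => /(le_trans _); apply; rewrite normrM nz mulr1.
have := ler_normD 1 (z ^+ k * z ^+ k); rewrite normrM nz mulr1 normr1 => h.
rewrite ger0_norm ?ler0z; last by lia.
by rewrite rmorphB /= lerB // (le_trans h).
Qed.

Lemma cube_lt_exp5 (n : nat) : (n ^ 3 < 5 ^ n)%N.
Proof.
elim: n => [|[|[|n]] IH] //; rewrite [(5 ^ _.+1)%N]expnS.
apply: leq_ltn_trans (_ : 5 * n.+2 ^ 3 < _)%N; last by rewrite ltn_pmul2l.
by rewrite !expnS !expn0; nia.
Qed.

(** Since q >= 3, the totient of q ^ a is at least two thirds of q ^ a; after cubing, the claim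
    follows from the square of [cube_lt_exp5]. *)
Lemma primepow_sq_lt_exp5_totient (q a : nat) :
  prime q -> odd q -> (0 < a)%N -> ((q ^ a) ^ 2 < 5 ^ totient (q ^ a))%N.
Proof.
move=> q_pr q_odd a0; rewrite -(@ltn_exp2r _ _ 3) //.
have q3 : (2 < q)%N by rewrite odd_prime_gt2.
have h : (((q ^ a) ^ 3) ^ 2 < (5 ^ (q ^ a)) ^ 2)%N.
  by rewrite ltn_exp2r // cube_lt_exp5.
rewrite expnAC; apply: leq_trans h _.
rewrite -!expnM leq_exp2l // totient_pfactor // -{1}(prednK a0) expnS.
have := expn_gt0 q a.-1; nia.
Qed.

Lemma odd_sq_lt_exp5_totient (n : nat) : odd n -> (n ^ 2 < 5 ^ totient n)%N.
Proof.
elim/ltn_ind: n => n IH n_odd.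
have [n1|n1] := leqP n 1; first by case: n n1 n_odd {IH} => [|[]].
have n0 : (0 < n)%N by lia.
set q := pdiv n; have q_pr : prime q := pdiv_prime n1.
have qn : (q %| n)%N := pdiv_dvd n.
have a0 : (0 < logn q n)%N by rewrite logn_gt0 mem_primes q_pr n0.
have q_odd : odd q by apply: dvdn_odd n_odd.
have P_odd : odd (q ^ logn q n) by rewrite oddX q_odd orbT.
have lt1 : (1 < q ^ logn q n)%N by rewrite -{1}(expn0 q) ltn_exp2l ?prime_gt1.
have hq := primepow_sq_lt_exp5_totient _ _ q_pr q_odd a0.
have co : coprime (q ^ logn q n) (n`_q^')%N.
  by rewrite -p_part coprime_partC.
move: (partnC q n0) co hq P_odd lt1; rewrite p_part.
move: (q ^ _)%N (n`_q^')%N => P k nE co hP P_odd lt1.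
have k_odd : odd k by move: n_odd; rewrite -{1}nE oddM => /andP[].
have [k1|k1] := leqP k 1.
  by case: k k1 k_odd nE {co} => [|[]] // _ _; rewrite muln1 => <-.
have kn : (k < n)%N by rewrite -nE -{1}(mul1n k) ltn_pmul2r //; lia.
have hk := IH k kn k_odd.
have P2 : (2 < P)%N by case: P lt1 P_odd {nE hP co} => [|[|[]]].
have k2 : (2 < k)%N by case: k k1 k_odd {nE kn hk co} => [|[|[]]].
rewrite -nE (totient_coprime co) expnMn.
(* Both totients are at least 2, so their sum is at most their product. *)
apply: leq_trans (_ : 5 ^ (totient P + totient k) <= _)%N.
  by rewrite expnD ltn_mul.
rewrite leq_exp2l //.
by have := totient_gt1 P; have := totient_gt1 k; rewrite P2 k2; nia.
Qed.

(** * Roots of the quadratic in characteristic p and in [algC] *)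

Lemma quadratic_roots_char (p : nat) (T Q : int) :
  prime p ->
  exists (K : closedFieldType) (a b : K),
    [/\ p \in [pchar K], a + b = T%:~R, a * b = Q%:~R
      & forall x : K, x ^+ p = x -> exists r : nat, x = r%:R].
Proof.
move=> p_pr; have [K [f _]] := countable_algebraic_closure 'F_p.
have [a /=] :=
  @solve_monicpoly K 2 (fun i => if i == 0 then - Q%:~R else T%:~R) isT.
rewrite big_ord_recl big_ord1 /= expr0 mulr1 expr1 => ha.
exists K, a, (T%:~R - a); split.
- by rewrite (fmorph_pchar f) pchar_Fp.
- by ring.
- by rewrite mulrBr -expr2 ha; ring.
move=> x xp.
(* X^p - X is the product of X - c over c in F_p, so a fixed point of Frobenius is the image of some
   such c. *)
have : root (map_poly f ('X^#|'F_p| - 'X)) x.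
  rewrite card_Fp // rmorphB /= map_polyXn map_polyX rootE !hornerE.
  by rewrite xp subrr.
rewrite finField_genPoly rmorph_prod /= -big_enum /=.
under eq_bigr do rewrite rmorphB /= map_polyX map_polyC /=.
rewrite -(big_map f predT (fun c => 'X - c%:P)) root_prod_XsubC.
case/mapP => c _ ->; exists (c : nat).
by rewrite -{1}(natr_Zp c) rmorph_nat.
Qed.

(** The norm vanishes in characteristic p, hence so does one of its two conjugate factors; if it is
    the second, a and b exchange names. *)
Lemma conj_norm_root (p : nat) (T Q s r : int) (e : nat) (P : {poly int}) :
  prime p -> conj_norm s P r -> (p %| r)%Z ->
  (forall (K : closedFieldType) (a b : K),
    a + b = T%:~R -> a * b = Q%:~R -> a ^+ e + b ^+ e = s%:~R) ->
  Q ^+ e = 1 ->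
  exists (K : closedFieldType) (a b : K),
    [/\ p \in [pchar K], a + b = T%:~R, a * b = Q%:~R,
        forall x : K, x ^+ p = x -> exists k : nat, x = k%:R
      & (map_poly intr P).[a ^+ e] = 0].
Proof.
move=> p_pr Pr pr tr Qe.
have [K [a [b [chK hs hp fix_p]]]] := quadratic_roots_char p T Q p_pr.
have hpe : a ^+ e * b ^+ e = 1 by rewrite -exprMn hp -rmorphXn /= Qe.
have /eqP := Pr K _ _ (tr K a b hs hp) hpe.
rewrite (eqP (_ : r%:~R == 0 :> K)) -?(dvdz_pcharf chK) // mulf_eq0.
case/orP=> /eqP r0; first by exists K, a, b.
by exists K, b, a; split; rewrite // 1?addrC 1?mulrC.
Qed.

Lemma sqr_trace (A : comPzRingType) (a b : A) (t : int) :
  a + b = t%:~R -> a * b = 1 -> a ^+ 2 + b ^+ 2 = (t ^+ 2 - 2)%:~R.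
Proof.
move=> hs hp; have -> : a ^+ 2 + b ^+ 2 = (a + b) ^+ 2 - 2 * (a * b) by ring.
by rewrite hs hp mulr1 rmorphB rmorphXn.
Qed.

Lemma quadratic_roots_algC (t : int) :
  exists a b : algC, a + b = t%:~R /\ a * b = 1.
Proof.
have [a] := @solve_monicpoly algC 2 (fun i => if i == 0 then -1 else t%:~R) isT.
rewrite big_ord_recl big_ord1 /= expr0 mulr1 expr1 => ha.
exists a, (t%:~R - a); split; first by ring.
by rewrite mulrBr -expr2 ha; ring.
Qed.

(** * Prime divisors of the cyclotomic norm *)

(** In characteristic 2 a root of X^2 - t X + 1 has order 1 or 3, whereas a root of ['Phi_N] has
    order divisible by the odd prime q >= 5. *)
Lemma Cyclotomic_norm_odd (t R : int) (N q : nat) :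
  (0 < N)%N -> prime q -> (5 <= q)%N -> (q %| N)%N ->
  conj_norm (t ^+ 2 - 2) 'Phi_N R -> ~ (2 %| R)%Z.
Proof.
move=> N0 q_pr q5 qN normR R2.
have [K [a [b [chK hs hp _ r0]]]] :=
  conj_norm_root 2 t 1 _ R 2 _ isT normR R2 (fun K a b => @sqr_trace K a b t)
    (expr1n _ _).
set d := a ^+ 2 in r0.
(* Over F_2 the polynomial X^2 - t X + 1 is (X + 1)^2 or X^2 + X + 1. *)
have d6 : d ^+ 6 = 1.
  have {}hp : a * b = 1 by [].
  have two0 : 2 = 0 :> K by apply/eqP; rewrite -(dvdn_pcharf chK 2).
  have aa : a ^+ 2 = t%:~R * a - 1 by rewrite -hs -hp; ring.
  have [t0|t1] : t%:~R = 0 :> K \/ t%:~R = 1 :> K.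
    have [k tk] : exists k : int, t = k * 2 \/ t = k * 2 + 1.
      by exists (t %/ 2)%Z; lia.
    have k0 : (k * 2)%:~R = 0 :> K by rewrite rmorphM rmorph_nat two0 mulr0.
    by case: tk => ->; [left | right; rewrite rmorphD /= k0 add0r].
  - by rewrite /d aa t0 mul0r add0r -signr_odd.
  have a2 : a ^+ 2 = a + 1 by rewrite aa t1 -[RHS]addr0 -{1}oppr0 -two0; ring.
  have a3 : a ^+ 3 = 1.
    rewrite exprS a2 mulrDr mulr1 -expr2 a2.
    have -> : a + 1 + a = 2 * a + 1 by ring.
    by rewrite two0 mul0r add0r.
  by rewrite /d -exprM -[(2 * 6)%N]/(3 * 4)%N exprM a3 expr1n.
have dN : (d ^+ (N %/ q)) ^+ q = 1.
  by rewrite -exprM divnK // (Cyclotomic_root_expr _ _ _ N0 r0).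
have /negP[] : d ^+ (N %/ q) != 1.
  apply: Cyclotomic_root_expr_neq1 => //.
  rewrite -(dvdn_pcharf chK) dvdn_prime2 //; lia.
have co : coprime q 6.
  rewrite prime_coprime // (_ : 6 = 2 * 3)%N // Euclid_dvdM // !dvdn_prime2 //.
  by lia.
have d6e : (d ^+ (N %/ q)) ^+ 6 = 1 by rewrite exprAC d6 expr1n.
have [k kx kq] := prim_order_exists (prime_gt0 q_pr) dN.
have k6 : (k %| 6)%N by rewrite (prim_order_dvd kx) d6e.
have : (k %| 1)%N by rewrite -(eqP co) dvdn_gcd kq.
by rewrite (prim_order_dvd kx) expr1.
Qed.

(** By [Cyclotomic_dvd_geometric], R divides the norm of a geometric sum with p terms. That norm is
    S ^ 2 with S congruent to p modulo p ^ 2, so p divides it exactly twice. *)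
Lemma Cyclotomic_norm_val (t R : int) (h p : nat) :
  (0 < h)%N -> prime p -> odd p -> (p %| h)%N ->
  conj_norm (t ^+ 2 - 2) 'Phi_(2 * h) R ->
  (p %| R)%Z -> ~ ((p ^ 3)%N %| R)%Z.
Proof.
move=> h0 p_pr p_odd ph normR pR p3R.
have N0 : (0 < 2 * h)%N by lia.
set e := (h %/ p)%N; have hE : h = (e * p)%N by rewrite divnK.
have [V [_ VE]] := pow_trace_int t e.
(* Frobenius turns a ^ (2 h) = -1 into a ^ (2 e) = -1, that is V ^ 2 = 0. *)
have pV : (p %| V)%Z.
  have [K [a [b [chK hs hp _ r0]]]] := conj_norm_root p t 1 _ R 2 _ p_pr normR
    pR (fun K a b => @sqr_trace K a b t) (expr1n _ _).
  have {}hp : a * b = 1 by [].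
  have := Cyclotomic_root_geometric _ _ 2 _ N0 isT (dvdn_mulr _ (dvdnn _)) r0.
  rewrite big_ord_recl big_ord1 mulKn // expr0 expr1 => /eqP.
  rewrite addr_eq0 eq_sym eqr_oppLR => /eqP; rewrite hE exprM => hm.
  have am : (a ^+ 2) ^+ e = -1.
    apply: (fmorph_inj (pFrobenius_aut chK)).
    by rewrite rmorphN rmorph1 /= pFrobenius_autE hm.
  have bm : (b ^+ 2) ^+ e = -1.
    have : (a ^+ 2) ^+ e * (b ^+ 2) ^+ e = 1.
      by rewrite -!exprM -exprMn hp expr1n.
    by rewrite am mulN1r => /eqP; rewrite eqr_oppLR => /eqP.
  have : (a ^+ e + b ^+ e) ^+ 2 = 0.
    rewrite sqrrD -exprMn hp expr1n [(a ^+ e) ^+ 2]exprAC.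
    by rewrite [(b ^+ e) ^+ 2]exprAC am bm; ring.
  rewrite (VE K a b hs hp) => /eqP; rewrite expf_eq0 /=.
  by rewrite -(dvdz_pcharf chK).
(* z is the trace of (a ^ 2) ^ (2 e), so S = p modulo p ^ 2. *)
set w := V ^+ 2 - 2; set z := w ^+ 2 - 2.
have p2z : ((p%:Z) ^+ 2 %| z - 2)%Z.
  have -> : z - 2 = V ^+ 2 * (w - 2) by rewrite /z /w; ring.
  by rewrite dvdz_mulr // dvdz_exp2r.
have [S [dS SE]] := centered_geometric_int z p./2.
have pE : ((2 * p./2).+1 = p)%N by rewrite mul2n -[RHS]odd_double_half p_odd.
rewrite pE in dS SE.
have [K KE] := Cyclotomic_dvd_geometric _ _ N0 p_pr (dvdn_mull 2 ph).
have [k kE] := conj_norm_exists (t ^+ 2 - 2) K.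
have [a [b [hs hp]]] := quadratic_roots_algC t.
have hs2 := sqr_trace _ _ _ _ hs hp.
have hp2 : a ^+ 2 * b ^+ 2 = 1 by rewrite -exprMn hp expr1n.
have RkS : R * k = S ^+ 2.
  apply: (@intr_inj algC); rewrite rmorphM rmorphXn /=.
  rewrite -(kE _ _ _ hs2 hp2) -(normR _ _ _ hs2 hp2) mulrACA -!hornerM.
  rewrite -!rmorphM -KE !rmorph_sum !horner_sum /=.
  have Ne : (2 * h %/ p = e * 2)%N by rewrite hE mulnA mulnK ?prime_gt0 // mulnC.
  pose x (c : algC) := (c ^+ 2) ^+ (e * 2).
  have G c : \sum_(i < p) (map_poly (intr : int -> algC)
       (('X^(2 * h %/ p)) ^+ i)).[c ^+ 2] = \sum_(i < p) x c ^+ i.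
    by apply: eq_bigr => i _; rewrite -exprM map_polyXn hornerXn Ne exprM.
  rewrite !G.
  have xs : x a + x b = z%:~R.
    rewrite /x !exprM; apply: sqr_trace; last by rewrite -exprMn hp2 expr1n.
    rewrite -!exprM mulnC !exprM; apply: sqr_trace; first exact: VE.
    by rewrite -exprMn hp expr1n.
  have xp : x a * x b = 1 by rewrite /x -exprMn hp2 expr1n.
  rewrite expr2 -{1}(SE _ _ _ xs xp) -(SE _ (x b) (x a)) 1?addrC 1?mulrC //.
  set A := \sum_(i < _) _; set B := \sum_(i < _) _.
  (* The inserted factor is 1; shared between the two sums, it makes each of them centred. *)
  transitivity ((x a * x b) ^+ p./2 * (A * B)); first by rewrite xp expr1n mul1r.
  by rewrite exprMn; ring.
have [y Sy] : exists y, S = p%:Z * (1 + p%:Z * y).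
  have /dvdzP[y hy] := dvdz_trans p2z dS.
  by exists y; rewrite -[S](subrK p%:Z) hy; ring.
have : ((p ^ 3)%N %| S ^+ 2)%Z by rewrite -RkS dvdz_mulr.
case/dvdzP=> c; rewrite Sy => hc.
have p0 : p%:Z != 0 by have := prime_gt0 p_pr; lia.
have sqE : (1 + p%:Z * y) ^+ 2 = c * p%:Z.
  apply: (mulfI (_ : p%:Z ^+ 2 != 0)); first by rewrite expf_neq0.
  by rewrite -exprMn hc !expnS expn0 !PoszM; ring.
have : (p %| 1)%Z.
  apply/dvdzP; exists (c - (2 * y + p%:Z * y ^+ 2)).
  by rewrite mulrBl -sqE; ring.
by rewrite dvdz1 => /eqP p1; move: p_pr; rewrite (p1 : p = 1%N).
Qed.

Lemma primitive_prime_exists (t R : int) (h q : nat) :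
  5 <= t ^+ 2 - 4 -> (0 < h)%N -> prime q -> (5 <= q)%N -> (q %| h)%N ->
  conj_norm (t ^+ 2 - 2) 'Phi_(2 * h) R ->
  exists p : nat, [/\ prime p, (p %| R)%Z & ~~ (p %| 2 * h)%N].
Proof.
move=> t5 h0 q_pr q5 qh normR.
have N0 : (0 < 2 * h)%N by lia.
set N := (2 * h)%N in N0 normR *.
have geR : (5 ^ totient N <= `|R|)%N.
  have t2 : 2 <= t ^+ 2 - 2 by lia.
  have [a [b [hs hp]]] := quadratic_roots_algC t.
  have hp2 : a ^+ 2 * b ^+ 2 = 1 by rewrite -exprMn hp expr1n.
  have := Cyclotomic_norm_ge _ _ _ _ N0 t2 (sqr_trace _ _ _ _ hs hp) hp2.
  rewrite (normR _ _ _ (sqr_trace _ _ _ _ hs hp) hp2) -intr_norm -rmorphXn /=.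
  rewrite ler_int => ge; rewrite -lez_nat abszE.
  rewrite -[Posz (5 ^ _)]natz natrX; apply: le_trans ge.
  by apply: lerXn2r; rewrite ?nnegrE; lia.
have R0 : (0 < `|R|)%N by rewrite (leq_trans _ geR) // expn_gt0.
have [//|nop] := pselect (exists p : nat,
   [/\ prime p, (p %| R)%Z & ~~ (p %| N)%N]).
set k := (h`_2^')%N.
have hk : (h`_2 * k)%N = h by rewrite partnC.
have k_odd : odd k.
  by rewrite odd_2'nat part_pnat.
(* By [nop] every prime divisor of R divides N; [Cyclotomic_norm_odd] excludes 2 and
   [Cyclotomic_norm_val] limits the exponent of an odd prime to 2. *)
suff dvdR : (`|R| %| k ^ 2)%N.
  have := dvdn_leq _ dvdR; rewrite expn_gt0 odd_gt0 // => /(_ isT) leR.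
  have le5 : (5 ^ totient k <= 5 ^ totient N)%N.
    rewrite leq_exp2l // /N -hk mulnA totient_coprime.
      rewrite -{1}(mul1n (totient k)) leq_mul2r totient_gt0; apply/orP; right.
      by rewrite muln_gt0 part_gt0.
    by rewrite coprimeMl coprime2n k_odd coprime_partC.
  have := leq_trans (odd_sq_lt_exp5_totient _ k_odd)
    (leq_trans le5 (leq_trans geR leR)).
  by rewrite ltnn.
apply/dvdn_partP => // p; rewrite mem_primes => /and3P[p_pr _ pR].
have pN : (p %| N)%N by apply/negPn/negP => np; apply: nop; exists p.
have p2 : p != 2%N.
  apply: contraPneq pR => ->.
  exact: (Cyclotomic_norm_odd _ _ _ _ N0 q_pr q5 (dvdn_mull 2 qh) normR).
have p_odd : odd p by case: (even_prime p_pr) p2 => [->|].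
have ph : (p %| h)%N.
  by move: pN; rewrite /N Euclid_dvdM // dvdn_prime2 // (negPf p2).
have pk : (p %| k)%N.
  move: ph; rewrite -{1}hk Gauss_dvdr // p_part coprimeXr //.
  by rewrite coprimen2.
rewrite p_part; apply: dvdn_trans (_ : p ^ 2 %| _)%N; last by rewrite dvdn_exp2r.
apply: dvdn_exp2l; rewrite leqNgt -pfactor_dvdn //; apply/negP => p3.
exact: (Cyclotomic_norm_val _ _ _ _ h0 p_pr p_odd ph normR pR p3).
Qed.

(** * Frobenius and a square root of the discriminant *)

Lemma prim_root_prod_1sub (F : fieldType) (n : nat) (z : F) :
  n.-primitive_root z -> \prod_(1 <= i < n) (1 - z ^+ i) = n%:R.
Proof.
move=> pz; have n0 := prim_order_gt0 pz.
have := factor_Xn_sub_1 pz; rewrite big_ltn // expr0 subrX1.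
have nz : 'X - 1%:P != 0 :> {poly F} by rewrite polyXsubC_eq0.
move/(mulfI nz)/(congr1 (fun P => P.[1])).
rewrite horner_prod horner_sum.
under eq_bigr do rewrite !hornerE.
move=> ->; under eq_bigr do rewrite hornerXn expr1n.
by rewrite sumr_const card_ord.
Qed.

(** With y a power of z such that y^2 = z, pairing i with 4 l + 1 - i in [prim_root_prod_1sub] gives
    (1 - z^i)(1 - z^-i) = -(y^i - y^-i)^2. The 2 l signs cancel, and they cancel again when z is
    mapped to its inverse, which negates each y^i - y^-i. *)
Lemma sqrt_nat_prim_root (F : fieldType) (l : nat) (z : F) :
  (4 * l).+1.-primitive_root z ->
  exists2 S : F, S ^+ 2 = (4 * l).+1%:R
    & forall f : {rmorphism F -> F}, f z = z^-1 -> f S = S.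
Proof.
move=> pz; have := prim_root_prod_1sub _ _ _ pz.
pose y := z ^+ (2 * l).+1.
have zu : z != 0.
  apply/eqP => z0; move/eqP: (prim_expr_order pz).
  by rewrite z0 expr0n /= eq_sym oner_eq0.
have yu : y != 0 by rewrite expf_neq0.
have yz : y ^+ 2 = z.
  rewrite -exprM (_ : (2 * l).+1 * 2 = (4 * l).+1 + 1)%N; last by lia.
  by rewrite exprD (prim_expr_order pz) mul1r.
have fyE (f : {rmorphism F -> F}) : f z = z^-1 -> f y = y^-1.
  by move=> fz; rewrite rmorphXn /= fz exprVn.
clearbody y.
have sgn : \prod_(1 <= i < (2 * l).+1) (-1 : F) = 1.
  by rewrite prodr_const_nat subn1 /= exprM sqrrN expr1n expr1n.
rewrite (@big_cat_nat _ _ _ (2 * l).+1) //=; last by lia.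
rewrite (big_addn 1 _ (2 * l)) (_ : (4 * l).+1 - 2 * l = (2 * l).+1)%N; last by lia.
rewrite [X in _ * X]big_nat_rev -big_split /=.
rewrite (eq_big_nat _ _ (F2 := fun i => -1 * (y ^+ i - y ^- i) ^+ 2)); last first.
  move=> i hi; have -> : (1 + (2 * l).+1 - i.+1 + 2 * l = (4 * l).+1 - i)%N by lia.
  rewrite expfB; last by lia.
  rewrite (prim_expr_order pz) -yz -!exprM ![(2 * i)%N]mulnC !exprM.
  by field; rewrite expf_neq0.
rewrite big_split /= sgn mul1r prodrXl => SE.
exists (\prod_(1 <= i < (2 * l).+1) (y ^+ i - y ^- i)); first exact: SE.
move=> f fz; have fy := fyE f fz.
rewrite rmorph_prod /=.
transitivity (\prod_(1 <= i < (2 * l).+1) (-1 * (y ^+ i - y ^- i))).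
  apply: eq_bigr => i _.
  by rewrite rmorphB fmorphV !rmorphXn /= fy exprVn invrK mulN1r opprB.
by rewrite big_split /= sgn mul1r.
Qed.

Lemma unit_root_frobenius_fixed (K : fieldType) (p m l : nat) (T Q D1 : int)
    (a b : K) :
  p \in [pchar K] -> odd p -> a + b = T%:~R -> a * b = Q%:~R ->
  m.-primitive_root a -> T ^+ 2 - 4 * Q = (4 * l).+1%:Z * D1 ^+ 2 ->
  Q = 1 /\ (4 * (4 * l).+1 %| m)%N \/ Q = -1 /\ (8 * (4 * l).+1 %| m)%N ->
  a ^+ p = a.
Proof.
move=> chK p_odd hs hp pa disc Qm; set n := (4 * l).+1 in disc Qm.
pose phi : {rmorphism K -> K} := pFrobenius_aut chK.
have phiE x : phi x = x ^+ p by rewrite /= pFrobenius_autE.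
rewrite -phiE.
have phiZ (k : int) : phi k%:~R = k%:~R by rewrite rmorph_int.
have : (phi a - a) * (phi a - b) = 0.
  have -> : (phi a - a) * (phi a - b)
      = phi a * phi a - (a + b) * phi a + a * b by ring.
  transitivity (phi (a * a - (a + b) * a + a * b)).
    by rewrite hs hp rmorphD rmorphB !rmorphM !phiZ.
  by rewrite (_ : _ + _ = 0) ?rmorph0 //; ring.
move/eqP; rewrite mulf_eq0 !subr_eq0 => /orP[/eqP//|/eqP ab].
(* From here on Frobenius exchanges a and b. *)
have phib : phi b = a.
  by apply: (addrI b); rewrite -{1}ab -rmorphD hs phiZ -hs addrC.
have ap : a ^+ p.+1 = Q%:~R by rewrite exprS -phiE ab.
have np : (n %| p.+1)%N /\ (n %| m)%N.
  case: Qm => -[Q1 dm].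
    have mp : (m %| p.+1)%N by rewrite (prim_order_dvd pa) ap Q1.
    have dn : (n %| m)%N := dvdn_trans (dvdn_mull 4 (dvdnn n)) dm.
    by split=> //; apply: dvdn_trans mp.
  (* For Q = -1 only a ^ (2 (p + 1)) = 1 is available; the oddness of n removes the factor 2. *)
  have mp : (m %| p.+1 * 2)%N.
    by rewrite (prim_order_dvd pa) exprM ap Q1 rmorphN rmorph1 sqrrN expr1n.
  have dn : (n %| m)%N := dvdn_trans (dvdn_mull 8 (dvdnn n)) dm.
  split=> //; have := dvdn_trans dn mp; rewrite Gauss_dvdl //.
  by rewrite coprimen2 /n /= oddM.
case: np => np nm.
have pz := dvdn_prim_root pa nm; set z := a ^+ (m %/ n) in pz.
have [S S2 Sfix] := sqrt_nat_prim_root _ _ _ pz.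
have fz : phi z = z^-1.
  have zp : phi z * z = 1.
    by rewrite phiE -exprSr; apply/eqP; rewrite -(prim_order_dvd pz).
  have zu : z != 0.
    by apply: contra_eq_neq zp => ->; rewrite mulr0 eq_sym oner_eq0.
  by apply: (mulIf zu); rewrite zp mulVf.
have /eqP : (a - b) ^+ 2 = (S * D1%:~R) ^+ 2.
  rewrite exprMn S2 -rmorphXn /=.
  have -> : (a - b) ^+ 2 = (a + b) ^+ 2 - 4 * (a * b) by ring.
  rewrite hs hp -[n%:R]/(n%:~R) -rmorphM /= -disc.
  by rewrite rmorphB rmorphXn rmorphM rmorph_nat.
have fS : phi (S * D1%:~R) = S * D1%:~R by rewrite rmorphM phiZ Sfix.
have fab : phi (a - b) = b - a by rewrite rmorphB ab phib.
(* Frobenius negates a - b but fixes it, as a - b is S D1 up to sign; p being odd, a = b, and so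
   [ab] becomes the claim. *)
rewrite eqf_sqr => eS; have {}fab : b - a = a - b.
  by rewrite -fab; case/orP: eS => /eqP ->; rewrite ?rmorphN fS.
have two : 2 != 0 :> K.
  rewrite -(dvdn_pcharf chK 2) dvdn_prime2 ?(pcharf_prime chK) //.
  by case: eqP p_odd => // ->.
have : 2 * (a - b) = 0 by rewrite -[X in _ = X](subrr (a - b)) -{3}fab; ring.
by move/eqP; rewrite mulf_eq0 (negPf two) subr_eq0 ab /= eq_sym => /eqP.
Qed.

(** * Linear recurrences and their residues *)

(** The action of polynomials on sequences in which ['X] is the shift. The annihilators of [s] form
    an ideal, so a recurrence for f passes to its multiple g. *)
Definition poly_shift (s : nat -> int) (P : {poly int}) (k : nat) : int :=
  \sum_(i < size P) P`_i * s (i + k)%N.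

Lemma poly_shift_widen (s : nat -> int) (P : {poly int}) (k N : nat) :
  (size P <= N)%N -> poly_shift s P k = \sum_(i < N) P`_i * s (i + k)%N.
Proof.
move=> leN; rewrite /poly_shift (big_ord_widen N (fun i => P`_i * s (i + k)%N)) //.
rewrite big_mkcond; apply: eq_bigr => i _; case: ltnP => // h.
by rewrite nth_default // mul0r.
Qed.

Lemma poly_shift_mul (s : nat -> int) (h f : {poly int}) (k : nat) :
  (forall j, poly_shift s f j = 0) -> poly_shift s (h * f) k = 0.
Proof.
move=> f0; elim/poly_ind: h k => [|h c IH] k.
  by rewrite mul0r /poly_shift size_poly0 big_ord0.
(* A common length for all the sums; the successor leaves room for the multiplication by ['X]. *)
pose N := maxn (size (h * f)).+1 (size f).
have le1 : (size (h * f)%R <= N.-1)%N by rewrite /N; lia.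
have le2 : (size f <= N)%N by rewrite leq_maxr.
have N0 : (0 < N)%N by rewrite /N; lia.
have E : (h * 'X + c%:P) * f = h * f * 'X + c *: f by rewrite -mul_polyC; ring.
have le3 : (size ((h * 'X + c%:P) * f)%R <= N)%N.
  rewrite E (leq_trans (size_polyD _ _)) // geq_max.
  rewrite (leq_trans (size_scale_leq _ _)) ?leq_maxr // andbT.
  have [->|nz] := eqVneq (h * f) 0; first by rewrite mul0r size_poly0.
  by rewrite size_mulX // leq_maxl.
rewrite (poly_shift_widen _ _ _ _ le3) E.
under eq_bigr do rewrite coefD coefZ mulrDl -[c * _ * _]mulrA.
rewrite big_split /= -mulr_sumr -(poly_shift_widen _ _ _ _ le2) f0 mulr0 addr0.
rewrite -{}(prednK N0) big_ord_recl coefMX mul0r add0r.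
under eq_bigr do rewrite coefMX /= /bump add1n /= addSnnS.
by rewrite -(poly_shift_widen _ _ _ _ le1) IH.
Qed.

Lemma is_lin_rec_of_shift (s : nat -> int) (g : {poly int}) :
  g \is monic -> (forall j, poly_shift s g j = 0) -> is_lin_rec g s.
Proof.
move=> g_monic g0 n le_rn; have := g0 (n - (size g).-1)%N.
have sg : (0 < size g)%N by rewrite size_poly_gt0 monic_neq0.
rewrite /poly_shift -(big_mkord predT (fun i => g`_i * s (i + (n - (size g).-1))%N)).
(* Reversed, the sum starts with the leading coefficient, and index i then matches
   [rec_coef g i]. *)
rewrite big_nat_rev big_ltn //= => /eqP; rewrite addr_eq0.
rewrite add0n subn1 -lead_coefE (monicP g_monic) mul1r subnKC // => /eqP ->.
rewrite -sumrN; apply: eq_big_nat => i hi; rewrite /rec_coef mulNr.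
by congr (- (_`_ _ * s _)); move: (size g) le_rn sg hi => d; clear; lia.
Qed.

Definition two_term_rec (T Q r : int) (n : nat) : int :=
  (iter n (fun xy => (xy.2, T * xy.2 - Q * xy.1)) (1, r)).1.

Lemma two_term_recSS (T Q r : int) (n : nat) :
  two_term_rec T Q r n.+2
    = T * two_term_rec T Q r n.+1 - Q * two_term_rec T Q r n.
Proof. by []. Qed.

Lemma two_term_rec_geometric (A : comPzRingType) (T Q r : int) (n : nat) :
  (r%:~R : A) ^+ 2 = T%:~R * r%:~R - Q%:~R ->
  (two_term_rec T Q r n)%:~R = (r%:~R : A) ^+ n.
Proof.
move=> hr; elim/ltn_ind: n => -[|[|n]] IH //.
rewrite two_term_recSS rmorphB !rmorphM /= !IH //.
by rewrite -[in RHS]addn2 exprD hr exprS; ring.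
Qed.

Lemma residue_counts_prim_root (K : fieldType) (p m r : nat) (T Q : int)
    (f g : {poly int}) :
  f = 'X^2 - T *: 'X + Q%:P -> g \is monic -> (exists h, g = h * f) ->
  p \in [pchar K] -> (r%:R : K) ^+ 2 = T%:~R * r%:R - Q%:~R ->
  m.-primitive_root (r%:R : K) -> residue_counts g m.
Proof.
move=> fE g_monic [h gE] chK hr pr; have m0 := prim_order_gt0 pr.
split=> //; pose s := two_term_rec T Q r%:Z; exists s, p.
have sE n : (s n)%:~R = (r%:R : K) ^+ n by apply: two_term_rec_geometric.
have p_gt0 : (0 < p)%N by rewrite prime_gt0 // (pcharf_prime chK).
split=> //.
  apply: is_lin_rec_of_shift => // k; rewrite gE; apply: poly_shift_mul => j.
  have sz : (size f <= 3)%N.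
    rewrite fE; apply/leq_sizeP => i hi.
    by rewrite !coefE; case: i hi => [|[|[|i]]] //= _; rewrite !mulr0 subr0 addr0.
  rewrite (poly_shift_widen _ _ _ _ sz) !big_ord_recl big_ord0 /bump /= fE.
  rewrite !coefE /= !addSn !add0n /s two_term_recSS; ring.
have sP i j : ((s i %% p%:Z)%Z == (s j %% p%:Z)%Z) = (i == j %[mod m]).
  rewrite eqz_mod_dvd (dvdz_pcharf chK) rmorphB /= subr_eq0 !sE.
  by rewrite (eq_prim_root_expr pr).
have -> : residues s p = [set (s n %% p%:Z)%Z | n in `I_m]%classic.
  apply/seteqP; split=> x [n] /=; last by move=> _ <-; exists n.
  move=> _ <-; exists (n %% m)%N; first by rewrite /= ltn_mod.
  by apply/eqP; rewrite sP modn_mod.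
apply: inj_card_eq => i j; rewrite !inE /= => im jm /eqP.
by rewrite sP !modn_small // => /eqP.
Qed.

(** * Choice of the prime modulus and conclusion *)

Lemma unit_root_mod_prime (T Q D1 : int) (l m q : nat) :
  T ^+ 2 - 4 * Q = (4 * l).+1%:Z * D1 ^+ 2 -> D1 != 0 ->
  prime q -> (5 <= q)%N -> (q %| (4 * l).+1)%N -> (0 < m)%N ->
  Q = 1 /\ (4 * (4 * l).+1 %| m)%N \/ Q = -1 /\ (8 * (4 * l).+1 %| m)%N ->
  exists (K : fieldType) (p r : nat),
    [/\ p \in [pchar K], (r%:R : K) ^+ 2 = T%:~R * r%:R - Q%:~R
      & m.-primitive_root (r%:R : K)].
Proof.
move=> disc D1nz q_pr q5 qn m0 Qm.
have n5 : (5 <= (4 * l).+1)%N := leq_trans q5 (dvdn_leq (ltn0Sn _) qn).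
have D1sq : 1 <= D1 ^+ 2.
  by rewrite -gtz0_ge1 exprn_even_gt0.
have discge : (5 : int) <= T ^+ 2 - 4 * Q.
  rewrite disc; apply: le_trans (_ : (4 * l).+1%:Z * 1 <= _).
    by rewrite mulr1 lez_nat.
  by rewrite ler_pM2l.
(* Here t is the trace of a ^ (e / 2), an element of norm 1: t = T and e = 2 for Q = 1, t = T^2 + 2
   and e = 4 for Q = -1. *)
have [t [e [h [e2 mE nh t5 [Qe tr]]]]] : exists (t : int) (e h : nat),
    [/\ (e %| 4)%N, m = (2 * h * e)%N, ((4 * l).+1 %| h)%N, 5 <= t ^+ 2 - 4
      & Q ^+ e = 1 /\ forall (K : closedFieldType) (a b : K),
        a + b = T%:~R -> a * b = Q%:~R -> a ^+ e + b ^+ e = (t ^+ 2 - 2)%:~R].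
  case: Qm => -[QE /dvdnP[k mE]].
    exists T, 2, (k * (4 * l).+1)%N; rewrite QE expr1n in discge *; split=> //.
    - by rewrite mE; ring.
    - exact: dvdn_mull.
    by split=> // K a b; apply: sqr_trace.
  exists (T ^+ 2 + 2), 4, (k * (4 * l).+1)%N; split=> //.
  - by rewrite mE; ring.
  - exact: dvdn_mull.
  (* In this case t^2 - 4 = T^2 (T^2 + 4), which is at least 5 once T is nonzero. *)
  - have TT : 1 <= T ^+ 2 by rewrite QE in discge; move: (T ^+ 2) discge; clear; lia.
    move: (T ^+ 2) TT => x; clear; nia.
  rewrite QE; split=> // K a b hs hp.
  rewrite !(exprM _ 2 2); apply: sqr_trace.
    have -> : a ^+ 2 + b ^+ 2 = (a + b) ^+ 2 - 2 * (a * b) by ring.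
    by rewrite hs hp rmorphD rmorphXn /= rmorphN rmorph1 mulrN1 opprK.
  by rewrite -exprMn hp rmorphN rmorph1 sqrrN expr1n.
have h0 : (0 < h)%N by move: m0; rewrite mE !muln_gt0 => /andP[/andP[]].
have N0 : (0 < 2 * h)%N by rewrite muln_gt0.
have [R normR] := conj_norm_exists (t ^+ 2 - 2) 'Phi_(2 * h).
have [p [p_pr pR pN]] :=
  primitive_prime_exists _ _ _ _ t5 h0 q_pr q5 (dvdn_trans qn nh) normR.
have [K [a [b [chK hs hp fixp r0]]]] :=
  conj_norm_root p T Q _ R e _ p_pr normR pR tr Qe.
have p_odd : odd p.
  by case: (even_prime p_pr) pN => // ->; rewrite dvdn_mulr.
have pa : m.-primitive_root a.
  apply: prim_root_of_prime_quotients => // [|q' q'_pr q'm].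
    by rewrite mE mulnC exprM (Cyclotomic_root_expr _ _ _ N0 r0).
  (* As e is a power of 2, m and 2 h have the same prime divisors. *)
  have q'N : (q' %| 2 * h)%N.
    move: q'm; rewrite mE Euclid_dvdM // => /orP[//|q'e].
    have : (q' %| 2 ^ 2)%N by apply: dvdn_trans q'e e2.
    by rewrite Euclid_dvdX // => /andP[q'2 _]; apply: dvdn_mulr.
  rewrite mE mulnC -muln_divA // exprM; apply: Cyclotomic_root_expr_neq1 => //.
  rewrite -(dvdn_pcharf chK); apply: contraNN pN => pq.
  exact: dvdn_trans pq q'N.
have [r ar] := fixp _ (unit_root_frobenius_fixed _ _ _ _ _ _ _ _ _
  chK p_odd hs hp pa disc Qm).
exists K, p, r; rewrite -ar; split=> //.
by rewrite -hs -hp; ring.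
Qed.

(** Removing at most one factor 3 leaves a number above 1 that is prime to 6. The prime found serves
    to keep 2 from dividing the cyclotomic norm. *)
Lemma odd_prime_ge5_dvd (n : nat) :
  odd n -> (5 <= n)%N -> ~~ (9 %| n)%N ->
  exists q : nat, [/\ prime q, (5 <= q)%N & (q %| n)%N].
Proof.
move=> n_odd n5 n9.
have [k nE k3] : exists2 k, n = (k * 3)%N \/ n = k & ~~ (3 %| k)%N.
  have [/dvdnP[k nE]|n3] := boolP (3 %| n)%N; last by exists n; first right.
  exists k; first by left.
  by apply: contraNN n9 => k3; rewrite nE (@dvdn_mul 3 3 k 3).
have kn : (k %| n)%N by case: nE => ->; rewrite ?dvdn_mulr.
have k1 : (1 < k)%N by case: nE => nE; lia.
exists (pdiv k); split; rewrite ?pdiv_prime ?(dvdn_trans (pdiv_dvd k)) //.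
have q_pr := pdiv_prime k1.
have q_odd : odd (pdiv k) := dvdn_odd (dvdn_trans (pdiv_dvd k) kn) n_odd.
have q3 : pdiv k != 3%N by apply: contraNneq k3 => <-; apply: pdiv_dvd.
by case: (pdiv k) q_pr q_odd q3 => [|[|[|[|[|]]]]].
Qed.

Theorem theorem1p4
  (f g : {poly int}) (alpha beta : algC) (D0 D1 : int)
  (f_monic : f \is monic) (f_quadratic : size f = 3%N)
  (f_roots : map_poly (intr : int -> algC) f
             = ('X - alpha%:P) * ('X - beta%:P))
  (norm_pm1 : alpha * beta = 1 \/ alpha * beta = -1)
  (ratio_not_unity :
     ~ exists n : nat, (0 < n)%N /\ n.-unity_root (alpha / beta))
  (g_monic : g \is monic)
  (f_dvd_g : exists h : {poly int}, g = h * f)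
  (discE : (alpha - beta) ^+ 2 = (D0 * D1 ^+ 2)%:~R)
  (D0_squarefree : squarefreez D0)
  (D0_ge5 : 5 <= D0)
  (D0_mod4 : (D0 = 1 %[mod 4])%Z)
  (m : nat) (m_gt0 : (0 < m)%N)
  (m_dvd_neg : alpha * beta = -1 -> (8 * D0 %| m%:Z)%Z)
  (m_dvd_pos : alpha * beta = 1 -> (4 * D0 %| m%:Z)%Z) :
  residue_counts g m.
Proof.
pose T := - f`_1; pose Q := f`_0.
have rootsE : ('X - alpha%:P) * ('X - beta%:P)
    = 'X^2 - (alpha + beta) *: 'X + (alpha * beta)%:P.
  by rewrite -mul_polyC rmorphD rmorphM /=; ring.
have TE : alpha + beta = T%:~R.
  have := congr1 (fun P : {poly algC} => P`_1) f_roots.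
  rewrite rootsE coef_map !coefE /= mulr1 addr0 add0r => e.
  by rewrite /T rmorphN /= e opprK.
have QE : alpha * beta = Q%:~R.
  have := congr1 (fun P : {poly algC} => P`_0) f_roots.
  by rewrite rootsE coef_map !coefE /= mulr0 subr0 add0r.
have fE : f = 'X^2 - T *: 'X + Q%:P.
  apply/polyP => i; rewrite !coefE; case: i => [|[|[|i]]] /=.
  - by rewrite mulr0 subr0 add0r.
  - by rewrite mulr1 sub0r addr0 /T opprK.
  - by rewrite mulr0 subr0 addr0 -(monicP f_monic) lead_coefE f_quadratic.
  - by rewrite mulr0 subr0 addr0 nth_default // f_quadratic.
have disc : T ^+ 2 - 4 * Q = D0 * D1 ^+ 2.
  apply: (@intr_inj algC); rewrite -discE rmorphB rmorphXn rmorphM /= rmorph_nat.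
  by rewrite -TE -QE; ring.
(* Otherwise alpha = beta, and the ratio 1 is a root of unity. *)
have D1nz : D1 != 0.
  apply/eqP => D10; apply: ratio_not_unity; exists 1%N; split=> //.
  move/eqP: discE; rewrite D10 expr0n mulr0 sqrf_eq0 subr_eq0 => /eqP ab.
  have bnz : beta != 0.
    apply/eqP => b0; case: norm_pm1 => /eqP; rewrite b0 mulr0 eq_sym.
      by rewrite oner_eq0.
    by rewrite oppr_eq0 oner_eq0.
  by rewrite ab divff // unity_rootE expr1.
have [l D0E] : exists l : nat, D0 = (4 * l).+1%:Z by exists `|(D0 %/ 4)%Z|%N; lia.
have [q [q_pr q5 qn]] : exists q : nat,
    [/\ prime q, (5 <= q)%N & (q %| (4 * l).+1)%N].
  apply: odd_prime_ge5_dvd; first by rewrite /= oddM.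
    by lia.
  apply/negP => n9; have := D0_squarefree 3; rewrite D0E => /(_ n9); lia.
rewrite D0E in disc.
have Qm : Q = 1 /\ (4 * (4 * l).+1 %| m)%N \/ Q = -1 /\ (8 * (4 * l).+1 %| m)%N.
  case: norm_pm1 => ab; [left|right]; split.
  - by apply: (@intr_inj algC); rewrite -QE ab.
  - by have := m_dvd_pos ab; rewrite D0E.
  - by apply: (@intr_inj algC); rewrite -QE ab.
  - by have := m_dvd_neg ab; rewrite D0E.
have [K [p [r [chK hr pr]]]] :=
  unit_root_mod_prime _ _ _ _ _ _ disc D1nz q_pr q5 qn m_gt0 Qm.
exact: (residue_counts_prim_root _ _ _ _ _ _ _ _ fE g_monic f_dvd_g chK hr pr).
Qed.
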